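(* Let $\mathcal{M}$ be a unitary magma without nontrivial unit divisors and $k\ge0$ be an integer. Then the space $\mathsf{Deg}_k\mathcal{M}$ is a quotient operad of $\mathsf{C}\mathcal{M}$; that is, the linear span of all $\mathcal{M}$-cliques $\mathfrak{p}$ with $\mathrm{degr}(\mathfrak{p})\ge k+1$ is an operad ideal of $\mathsf{C}\mathcal{M}$.
   Context: All vector spaces are over a field $\mathbb{K}$ of characteristic zero; $[n]=\{1,\dots,n\}$. Operad means nonsymmetric operad in vector spaces, graded by arities $n\ge1$, with partial compositions $\circ_i$ and a unit in arity $1$. An operad ideal $I$ of $\mathcal{O}$ is a graded subspace such that for all $x\in\mathcal{O}$, $y\in I$, all $x\circ_iy$ and $y\circ_jx$ lie in $I$. A unitary magma is a set $\mathcal{M}$ with a binary operation $\star$ (not necessarily associative) having a two-sided unit $\mathds{1}_{\mathcal{M}}$. It has no nontrivial unit divisors if $a\star b=\mathds{1}_{\mathcal{M}}$ implies $a=b=\mathds{1}_{\mathcal{M}}$. An $\mathcal{M}$-clique $\mathfrak{p}$ of arity $n\ge1$ is a map assigning to every arc $(x,y)$, $1\le x<y\le n+1$, a label $\mathfrak{p}(x,y)\in\mathcal{M}$; by convention, the only $\mathcal{M}$-clique of arity $1$ is the one with $\mathfrak{p}(1,2)=\mathds{1}_{\mathcal{M}}$. Put $\mathfrak{p}_0:=\mathfrak{p}(1,n+1)$ and $\mathfrak{p}_i:=\mathfrak{p}(i,i+1)$ for $i\in[n]$. $\mathsf{C}\mathcal{M}$ is the operad whose space $\mathsf{C}\mathcal{M}(n)$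 is the linear span of all $\mathcal{M}$-cliques of arity $n$, whose unit is the unique $\mathcal{M}$-clique of arity $1$, and where, for $\mathcal{M}$-cliques $\mathfrak{p},\mathfrak{q}$ of arities $n,m$ and $i\in[n]$, $\mathfrak{p}\circ_i\mathfrak{q}$ is the $\mathcal{M}$-clique of arity $n+m-1$ with $$(\mathfrak{p}\circ_i\mathfrak{q})(x,y)=\begin{cases}\mathfrak{p}(x,y)&\text{if }y\le i,\\ \mathfrak{p}(x,y-m+1)&\text{if }x\le i<i+m\le y,\ (x,y)\ne(i,i+m),\\ \mathfrak{p}(x-m+1,y-m+1)&\text{if }i+m\le x,\\ \mathfrak{q}(x-i+1,y-i+1)&\text{if }i\le x<y\le i+m,\ (x,y)\ne(i,i+m),\\ \mathfrak{p}_i\star\mathfrak{q}_0&\text{if }(x,y)=(i,i+m),\\ \mathds{1}_{\mathcal{M}}&\text{otherwise.}\end{cases}$$ An arc (any pair $(x,y)$ with $1\le x<y\le n+1$) is solid if its label is not $\mathds{1}_{\mathcal{M}}$. The degree of a vertex $x\in[n+1]$ of $\mathfrak{p}$ is the number of solid arcs having $x$ as an endpoint, and $\mathrm{degr}(\mathfrak{p})$ is the maximal degree of the vertices of $\mathfrak{p}$. $\mathsf{Deg}_k\mathcal{M}$ is the quotient of graded spaces of $\mathsf{C}\mathcal{M}$ by the span of all $\mathcal{M}$-cliques $\mathfrak{p}$ with $\mathrm{degr}(\mathfrak{p})\ge k+1$; it is the linear span of all $\mathcal{M}$-cliques $\mathfrak{p}$ with $\mathrm{degr}(\mathfrak{p})\le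 k$. *)

(* Defs.v *)
From HB Require Import structures.
From mathcomp Require Import all_boot all_order all_algebra.
From mathcomp Require Import zify finmap.
From mathcomp Require Import monalg.

Set Implicit Arguments.
Unset Strict Implicit.
Unset Printing Implicit Defensive.

Import GRing.Theory.

Local Open Scope ring_scope.

(* Nonsymmetric operads in K-vector spaces, graded by arities n >= 1: the space
   [op_space O n] is the component of arity [n.+1], and inputs are numbered
   from 0.  Thus x of arity n.+1 and y of arity m.+1 compose into arity
   (n.+1) + (m.+1) - 1 = (n + m).+1.  Equations between elements whose arities
   are only propositionally equal are stated in the sigma-type
   {n & op_space O n}. *)
Record operad (K : fieldType) := Operad {
  op_space :> nat -> lmodType K;
  op_unit : op_space 0%N;
  op_comp : forall n m : nat, 'I_n.+1 ->
    op_space n -> op_space m -> op_space (n + m)%N;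
  op_comp_linear_l : forall (n m : nat) (i : 'I_n.+1) (y : op_space m),
    linear (fun x : op_space n => op_comp i x y);
  op_comp_linear_r : forall (n m : nat) (i : 'I_n.+1) (x : op_space n),
    linear (fun y : op_space m => op_comp i x y);
  op_unit_l : forall (n : nat) (x : op_space n),
    op_comp ord0 op_unit x = x;
  op_unit_r : forall (n : nat) (i : 'I_n.+1) (x : op_space n),
    Tagged op_space (op_comp i x op_unit) = Tagged op_space x;
  op_comp_seq : forall (n m l : nat) (i : 'I_n.+1) (j : 'I_m.+1)
      (ij : 'I_(n + m).+1) (x : op_space n) (y : op_space m) (z : op_space l),
    ij = (i + j)%N :> nat ->
    Tagged op_space (op_comp ij (op_comp i x y) z) =
    Tagged op_space (op_comp i x (op_comp j y z));
  op_comp_par : forall (n m l : nat) (i j : 'I_n.+1)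
      (jm : 'I_(n + m).+1) (i' : 'I_(n + l).+1)
      (x : op_space n) (y : op_space m) (z : op_space l),
    (i < j)%N -> jm = (j + m)%N :> nat -> i' = i :> nat ->
    Tagged op_space (op_comp jm (op_comp i x y) z) =
    Tagged op_space (op_comp i' (op_comp j x z) y)
}.

Definition subspace (K : fieldType) (V : lmodType K) (S : V -> Prop) : Prop :=
  S 0 /\ forall (a : K) (u v : V), S u -> S v -> S (a *: u + v).

Definition operad_ideal (K : fieldType) (O : operad K)
    (I : forall n : nat, O n -> Prop) : Prop :=
  [/\ forall n, subspace (@I n),
      forall (n m : nat) (i : 'I_n.+1) (x : O n) (y : O m),
        I m y -> I (n + m)%N (op_comp i x y)
    & forall (n m : nat) (j : 'I_n.+1) (y : O n) (x : O m),
        I n y -> I (n + m)%N (op_comp j y x)].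

Definition linear_span (K : fieldType) (V : lmodType K) (S : V -> Prop)
    (v : V) : Prop :=
  exists (r : nat) (c : 'I_r -> K) (u : 'I_r -> V),
    (forall i, S (u i)) /\ v = \sum_(i < r) c i *: u i.

Definition no_nontrivial_unit_divisors (M : umagmaType) : Prop :=
  forall a b : M, (a * b)%g = 1%g -> a = 1%g /\ b = 1%g.

(* The vertices 1, ..., n+1 are numbered 0, ..., n here, as elements of
   'I_n.+1. *)
Definition arc (n : nat) : finType :=
  {a : 'I_n.+1 * 'I_n.+1 | (a.1 < a.2)%N}.

Definition arc_src (n : nat) (a : arc n) : 'I_n.+1 := (val a).1.
Definition arc_tgt (n : nat) (a : arc n) : 'I_n.+1 := (val a).2.

(* Cliques of arity n; in arity 1 only the all-unit labelling is allowed. *)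
Definition clique (M : umagmaType) (n : nat) : choiceType :=
  {p : {ffun arc n -> M} | (n == 1)%N ==> [forall a, p a == 1%g]}.

(* The label p(x, y) as a function of natural numbers; the value 1 outside of
   the arcs of p is a default. *)
Definition label (M : umagmaType) (n : nat) (p : clique M n) (x y : nat) : M :=
  if [pick a : arc n | (arc_src a == x :> nat) && (arc_tgt a == y :> nat)]
    is Some a then val p a else 1%g.

Definition solid (M : umagmaType) (n : nat) (p : clique M n) (a : arc n) : bool :=
  val p a != 1%g.

Definition degree (M : umagmaType) (n : nat) (p : clique M n) (x : 'I_n.+1) :
    nat :=
  #|[set a : arc n | solid p a & (arc_src a == x) || (arc_tgt a == x)]|.

Definition degr (M : umagmaType) (n : nat) (p : clique M n) : nat :=
  \max_(x < n.+1) degree p x.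

(* Label of the arc (x, y) of the composition of p, of arity n.+1, with q, of
   arity m.+1, at input i.  With vertices and inputs numbered from 0, the edge
   p_i is (i, i.+1) and the base q_0 is (0, m.+1). *)
Definition comp_label (M : umagmaType) (n m : nat) (i : nat)
    (p : clique M n.+1) (q : clique M m.+1) (x y : nat) : M :=
  if (y <= i)%N then label p x y
  else if (x == i) && (y == i + m.+1)%N then
    (label p i i.+1 * label q 0 m.+1)%g
  else if (x <= i)%N && (i + m.+1 <= y)%N then label p x (y - m)
  else if (i + m.+1 <= x)%N then label p (x - m) (y - m)
  else if (i <= x)%N && (y <= i + m.+1)%N then label q (x - i) (y - i)
  else 1%g.

Lemma labelE (M : umagmaType) n (p : clique M n) (a : arc n) :
  label p (arc_src a) (arc_tgt a) = val p a.
Proof.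
rewrite /label; case: pickP => [b /andP[/eqP h1 /eqP h2]|/(_ a)]; last first.
  by rewrite !eqxx.
suff -> : b = a by [].
apply/val_inj; rewrite [val b]surjective_pairing [val a]surjective_pairing.
by congr pair; apply/val_inj.
Qed.

Lemma label_default (M : umagmaType) n (p : clique M n) x y :
  ~~ (x < y <= n)%N -> label p x y = 1%g.
Proof.
rewrite /label; case: pickP => // a /andP[/eqP<- /eqP<-].
by rewrite (valP a) /= -ltnS ltn_ord.
Qed.

Lemma label_arc (M : umagmaType) n (p : clique M n) x y :
  (x < y <= n)%N -> exists a : arc n,
  [/\ arc_src a = x :> nat, arc_tgt a = y :> nat & label p x y = val p a].
Proof.
move=> /andP[xy yn].
have xn : (x < n.+1)%N by rewrite ltnS (leq_trans (ltnW xy)).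
have yn' : (y < n.+1)%N by [].
pose a : arc n := Sub (Ordinal xn, Ordinal yn') xy.
by exists a; split=> //; rewrite -(labelE p a).
Qed.

Lemma label1 (M : umagmaType) (p : clique M 1) x y : label p x y = 1%g.
Proof.
have [xy|xy] := boolP (x < y <= 1)%N; last exact: label_default.
have [a [_ _ ->]] := label_arc p xy.
by case: p => p /= /forallP/(_ a)/eqP.
Qed.

Lemma clique_ext (M : umagmaType) n (p q : clique M n) :
  (forall x y, (x < y <= n)%N -> label p x y = label q x y) -> p = q.
Proof.
move=> h; apply/val_inj/ffunP => a; rewrite -!labelE; apply: h.
by rewrite (valP a) -ltnS ltn_ord.
Qed.

Lemma clique_comp_subproof (M : umagmaType) (n m : nat) (i : 'I_n.+1)
    (p : clique M n.+1) (q : clique M m.+1) :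
  ((n + m).+1 == 1)%N ==>
  [forall a, [ffun a : arc (n + m).+1 =>
               comp_label i p q (arc_src a) (arc_tgt a)] a == 1%g].
Proof.
apply/implyP; rewrite eqSS addn_eq0 => /andP[/eqP n0 /eqP m0]; subst n m.
apply/forallP => a; rewrite ffunE /comp_label !label1 mulg1.
by rewrite !if_same.
Qed.

Definition clique_comp (M : umagmaType) (n m : nat) (i : 'I_n.+1)
    (p : clique M n.+1) (q : clique M m.+1) : clique M (n + m).+1 :=
  Sub [ffun a : arc (n + m).+1 => comp_label i p q (arc_src a) (arc_tgt a)]
      (clique_comp_subproof i p q).

Lemma clique_unit_subproof (M : umagmaType) :
  (1 == 1)%N ==> [forall a, [ffun _ : arc 1 => 1%g : M] a == 1%g].
Proof. by apply/forallP => a; rewrite ffunE. Qed.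

Definition clique_unit (M : umagmaType) : clique M 1 :=
  Sub [ffun=> 1%g] (clique_unit_subproof M).

Lemma label_comp (M : umagmaType) n m (i : 'I_n.+1) (p : clique M n.+1)
    (q : clique M m.+1) x y :
  label (clique_comp i p q) x y =
  if (x < y <= (n + m).+1)%N then comp_label i p q x y else 1%g.
Proof.
case: ifP => [xy|/negbT xy]; last exact: label_default.
have [a [<- <- ->]] := label_arc (clique_comp i p q) xy.
by rewrite /= ffunE.
Qed.

Lemma Tagged_clique_ext (M : umagmaType) n n' (p : clique M n.+1)
    (q : clique M n'.+1) :
  n = n' ->
  (forall x y, (x < y <= n.+1)%N -> label p x y = label q x y) ->
  Tagged (fun k => clique M k.+1) p = Tagged (fun k => clique M k.+1) q.
Proof. by move=> e; subst n'; move/clique_ext->. Qed.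

Local Ltac label_lia :=
  first [reflexivity | apply: (f_equal2 (label _)); lia].
Local Ltac decide_conds :=
  repeat (cbn [andb]; match goal with |- context [if ?c then _ else _] =>
    match c with
    | context [(?a <= ?b)%N] => case: (leqP a b) => ?; try (exfalso; lia)
    | context [?a == ?b] => case: (ltngtP a b) => ?; try (exfalso; lia)
    end end).
Local Ltac comp_tac :=
  decide_conds;
  try first [label_lia | congr (_ * _)%g; label_lia
    | rewrite label_default //; lia | symmetry; rewrite label_default //; lia].

(* The operad axioms on cliques; they use the convention on arity 1 but neither
   associativity in M nor any condition on unit divisors. *)
Lemma clique_comp_unit_l (M : umagmaType) n (p : clique M n.+1) :
  clique_comp ord0 (clique_unit M) p = p.
Proof.
apply: clique_ext => x y xy.
rewrite label_comp -[nat_of_ord ord0]/0%N /comp_label !label1 mul1g.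
by comp_tac.
Qed.

Lemma clique_comp_unit_r (M : umagmaType) n (i : 'I_n.+1) (p : clique M n.+1) :
  Tagged (fun k => clique M k.+1) (clique_comp i p (clique_unit M)) =
  Tagged (fun k => clique M k.+1) p.
Proof.
apply: Tagged_clique_ext; first exact: addn0.
move=> x y xy.
have := ltn_ord i => ?.
rewrite label_comp /comp_label !label1 mulg1.
by comp_tac.
Qed.

Lemma clique_comp_seq (M : umagmaType) n m l (i : 'I_n.+1) (j : 'I_m.+1)
    (ij : 'I_(n + m).+1) (p : clique M n.+1) (q : clique M m.+1)
    (r : clique M l.+1) :
  ij = (i + j)%N :> nat ->
  Tagged (fun k => clique M k.+1) (clique_comp ij (clique_comp i p q) r) =
  Tagged (fun k => clique M k.+1) (clique_comp i p (clique_comp j q r)).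
Proof.
move=> e; apply: Tagged_clique_ext; first by rewrite addnA.
move=> x y xy.
case: m => [|m] in j ij q e xy *; have := ltn_ord i; have := ltn_ord j => ? ?.
  rewrite !label_comp /comp_label !label_comp /comp_label !label1 e ?mulg1 ?mul1g.
  by comp_tac.
rewrite !label_comp /comp_label !label_comp /comp_label e.
by comp_tac.
Qed.

Lemma clique_comp_par (M : umagmaType) n m l (i j : 'I_n.+1)
    (jm : 'I_(n + m).+1) (i' : 'I_(n + l).+1)
    (p : clique M n.+1) (q : clique M m.+1) (r : clique M l.+1) :
  (i < j)%N -> jm = (j + m)%N :> nat -> i' = i :> nat ->
  Tagged (fun k => clique M k.+1) (clique_comp jm (clique_comp i p q) r) =
  Tagged (fun k => clique M k.+1) (clique_comp i' (clique_comp j p r) q).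
Proof.
move=> ij e e'; apply: Tagged_clique_ext; first by lia.
move=> x y xy; have := ltn_ord i; have := ltn_ord j => ? ?.
rewrite !label_comp /comp_label !label_comp /comp_label e e'.
by comp_tac.
Qed.

Definition cliques_space (K : fieldType) (M : umagmaType) (n : nat) :
    lmodType K :=
  {malg K[clique M n.+1]}.

Definition cliques_comp (K : fieldType) (M : umagmaType) (n m : nat)
    (i : 'I_n.+1) (x : cliques_space K M n) (y : cliques_space K M m) :
    cliques_space K M (n + m) :=
  \sum_(p <- msupp x) \sum_(q <- msupp y)
    << x@_p * y@_q *g clique_comp i p q >>.

Section LinearExtension.
Variable K : fieldType.

Lemma malg_sum_linear (T : choiceType) (V : lmodType K) (h : T -> V) :
  linear (fun f : {malg K[T]} => \sum_(t <- msupp f) f@_t *: h t).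
Proof.
have widen (d : {fset T}) (f : {malg K[T]}) : (msupp f `<=` d)%fset ->
    \sum_(t <- msupp f) f@_t *: h t = \sum_(t <- d) f@_t *: h t.
  move=> le_fd; apply: big_fset_incl => // t _ /mcoeff_outdom ->.
  by rewrite scale0r.
move=> a f g; pose d := (msupp (a *: f + g) `|` (msupp f `|` msupp g))%fset.
rewrite !(widen d) /d; first last.
- exact: fsubsetUl.
- by apply: fsubsetU; rewrite fsubsetUl orbT.
- by apply: fsubsetU; rewrite fsubsetUr orbT.
rewrite scaler_sumr -big_split /=; apply: eq_bigr => t _.
by rewrite mcoeffD mcoeffZ scalerDl scalerA.
Qed.

Lemma malgU_scale (T : choiceType) (c : K) (t : T) :
  << c *g t >> = c *: << t >> :> {malg K[T]}.
Proof. by apply/malgP => s; rewrite mcoeffZ !mcoeffU mulrnAr mulr1. Qed.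

Lemma linear_malg_ext (T : choiceType) (V : lmodType K)
    (f g : {malg K[T]} -> V) :
  linear f -> linear g -> (forall t, f << t >> = g << t >>) -> f =1 g.
Proof.
move=> lf lg fg x.
have l0 (h : {malg K[T]} -> V) : linear h -> h 0 = 0.
  by move=> lh; have := lh (-1) 0 0; rewrite scaler0 addr0 scaleN1r addNr.
rewrite (monalgE x); elim: (enum_fset (msupp x)) => [|t s IH].
  by rewrite !big_nil !l0.
by rewrite !big_cons malgU_scale lf lg fg IH.
Qed.

Lemma Tagged_linear_malg_ext (T : choiceType) (V : nat -> lmodType K) n n'
    (f : {malg K[T]} -> V n) (g : {malg K[T]} -> V n') :
  n = n' -> linear f -> linear g ->
  (forall t, Tagged V (f << t >>) = Tagged V (g << t >>)) ->
  forall x, Tagged V (f x) = Tagged V (g x).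
Proof.
move=> e; subst n' => lf lg fg x; congr (Tagged V _).
apply: linear_malg_ext x => // t.
have /(congr1 (tagged_as (Tagged V (f << t >>)))) := fg t.
by rewrite !tagged_asE.
Qed.

Variable M : umagmaType.

Lemma cliques_comp_linear_l n m (i : 'I_n.+1) (y : cliques_space K M m) :
  linear (fun x : cliques_space K M n => cliques_comp i x y).
Proof.
pose h p := \sum_(q <- msupp y) y@_q *: (<< clique_comp i p q >> :
  {malg K[clique M (n + m).+1]}).
have E x : cliques_comp i x y = \sum_(p <- msupp x) x@_p *: h p.
  apply: eq_bigr => p _; rewrite scaler_sumr; apply: eq_bigr => q _.
  by rewrite scalerA -malgU_scale.
by move=> a u v; rewrite !E; exact: malg_sum_linear.
Qed.

Lemma cliques_comp_linear_r n m (i : 'I_n.+1) (x : cliques_space K M n) :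
  linear (fun y : cliques_space K M m => cliques_comp i x y).
Proof.
pose h q := \sum_(p <- msupp x) x@_p *: (<< clique_comp i p q >> :
  {malg K[clique M (n + m).+1]}).
have E y : cliques_comp i x y = \sum_(q <- msupp y) y@_q *: h q.
  rewrite /cliques_comp exchange_big; apply: eq_bigr => q _.
  rewrite scaler_sumr; apply: eq_bigr => p _.
  by rewrite scalerA -malgU_scale mulrC.
by move=> a u v; rewrite !E; exact: malg_sum_linear.
Qed.

Lemma cliques_compU n m (i : 'I_n.+1) (p : clique M n.+1)
    (q : clique M m.+1) :
  cliques_comp i (<< p >> : cliques_space K M n) << q >> =
  << clique_comp i p q >>.
Proof.
rewrite /cliques_comp !msuppU oner_eq0 !big_seq_fset1.
by rewrite !mcoeffUU mulr1.
Qed.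

Lemma cliques_compPl n m (i : 'I_n.+1) a (u v : cliques_space K M n)
    (y : cliques_space K M m) :
  cliques_comp i (a *: u + v) y = a *: cliques_comp i u y + cliques_comp i v y.
Proof. exact: cliques_comp_linear_l. Qed.

Lemma cliques_compPr n m (i : 'I_n.+1) a (x : cliques_space K M n)
    (u v : cliques_space K M m) :
  cliques_comp i x (a *: u + v) = a *: cliques_comp i x u + cliques_comp i x v.
Proof. exact: cliques_comp_linear_r. Qed.

Lemma Tagged_cliqueU n n' (p : clique M n.+1) (q : clique M n'.+1) :
  Tagged (fun k => clique M k.+1) p = Tagged (fun k => clique M k.+1) q ->
  Tagged (cliques_space K M) (<< p >> : cliques_space K M n) =
  Tagged (cliques_space K M) (<< q >> : cliques_space K M n').
Proof.
exact: (congr1 (fun u : {k : nat & clique M k.+1} =>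
  Tagged (cliques_space K M)
    (<< tagged u >> : cliques_space K M (tag u)))).
Qed.

Lemma cliques_comp_unit_l n (x : cliques_space K M n) :
  cliques_comp ord0 (<< clique_unit M >> : cliques_space K M 0) x = x.
Proof.
apply: (linear_malg_ext (f := fun x : cliques_space K M n =>
  cliques_comp ord0 (<< clique_unit M >> : cliques_space K M 0) x)
  (g := fun x => x)).
- exact: cliques_comp_linear_r.
- by [].
- by move=> p; rewrite cliques_compU clique_comp_unit_l.
Qed.

Lemma cliques_comp_unit_r n (i : 'I_n.+1) (x : cliques_space K M n) :
  Tagged (cliques_space K M)
    (cliques_comp i x (<< clique_unit M >> : cliques_space K M 0)) =
  Tagged (cliques_space K M) x.
Proof.
move: x; apply: Tagged_linear_malg_ext (addn0 n) _ _ _ => //.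
  exact: cliques_comp_linear_l.
move=> p; rewrite cliques_compU; apply: Tagged_cliqueU.
exact: clique_comp_unit_r.
Qed.

Lemma cliques_comp_seq n m l (i : 'I_n.+1) (j : 'I_m.+1)
    (ij : 'I_(n + m).+1) (x : cliques_space K M n) (y : cliques_space K M m)
    (z : cliques_space K M l) :
  ij = (i + j)%N :> nat ->
  Tagged (cliques_space K M) (cliques_comp ij (cliques_comp i x y) z) =
  Tagged (cliques_space K M) (cliques_comp i x (cliques_comp j y z)).
Proof.
move=> e; have e' : (n + m + l = n + (m + l))%N by rewrite addnA.
move: x; apply: (Tagged_linear_malg_ext e') => [||p].
- by move=> a u v; rewrite ?(cliques_compPl, cliques_compPr).
- by move=> a u v; rewrite ?(cliques_compPl, cliques_compPr).
move: y; apply: (Tagged_linear_malg_ext e') => [||q].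
- by move=> a u v; rewrite ?(cliques_compPl, cliques_compPr).
- by move=> a u v; rewrite ?(cliques_compPl, cliques_compPr).
move: z; apply: (Tagged_linear_malg_ext e') => [||r].
- by move=> a u v; rewrite ?(cliques_compPl, cliques_compPr).
- by move=> a u v; rewrite ?(cliques_compPl, cliques_compPr).
by rewrite !cliques_compU; apply: Tagged_cliqueU; exact: clique_comp_seq.
Qed.

Lemma cliques_comp_par n m l (i j : 'I_n.+1) (jm : 'I_(n + m).+1)
    (i' : 'I_(n + l).+1) (x : cliques_space K M n) (y : cliques_space K M m)
    (z : cliques_space K M l) :
  (i < j)%N -> jm = (j + m)%N :> nat -> i' = i :> nat ->
  Tagged (cliques_space K M) (cliques_comp jm (cliques_comp i x y) z) =
  Tagged (cliques_space K M) (cliques_comp i' (cliques_comp j x z) y).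
Proof.
move=> lt_ij ej ei; have e' : (n + m + l = n + l + m)%N by rewrite addnAC.
move: x; apply: (Tagged_linear_malg_ext e') => [||p].
- by move=> a u v; rewrite ?(cliques_compPl, cliques_compPr).
- by move=> a u v; rewrite ?(cliques_compPl, cliques_compPr).
move: y; apply: (Tagged_linear_malg_ext e') => [||q].
- by move=> a u v; rewrite ?(cliques_compPl, cliques_compPr).
- by move=> a u v; rewrite ?(cliques_compPl, cliques_compPr).
move: z; apply: (Tagged_linear_malg_ext e') => [||r].
- by move=> a u v; rewrite ?(cliques_compPl, cliques_compPr).
- by move=> a u v; rewrite ?(cliques_compPl, cliques_compPr).
by rewrite !cliques_compU; apply: Tagged_cliqueU; exact: clique_comp_par.
Qed.

End LinearExtension.

Definition clique_operad (K : fieldType) (M : umagmaType) : operad K :=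
  @Operad K (cliques_space K M) << clique_unit M >> (@cliques_comp K M)
    (@cliques_comp_linear_l K M) (@cliques_comp_linear_r K M)
    (@cliques_comp_unit_l K M) (@cliques_comp_unit_r K M)
    (@cliques_comp_seq K M) (@cliques_comp_par K M).

(* The graded subspace whose quotient is Deg_k M. *)
Definition large_degree_span (K : fieldType) (M : umagmaType) (k n : nat) :
    clique_operad K M n -> Prop :=
  linear_span (fun v : cliques_space K M n =>
    exists2 p : clique M n.+1, (k.+1 <= degr p)%N & v = << p >>).

Arguments operad_ideal {K} O I.
Arguments large_degree_span K M k n _ : clear implicits.

(* Main.v *)
Require Import Defs.
From mathcomp Require Import all_boot all_order all_algebra.
From mathcomp Require Import zify finmap.
From mathcomp Require Import monalg.

(** A composition of cliques [p] and [q] at [i] draws [p] and [q] side by side: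
    the vertices of each factor embed in the composite by an increasing map
    ([expand i m] for [p], the shift by [i] for [q]), and every arc of a factor
    keeps its label, except that the edge [p_i] and the base [q_0] are merged
    into one arc labelled by their product.  As [M] has no nontrivial unit
    divisors, this product is not the unit as soon as one of its factors is
    not.  Solid arcs are thus sent injectively to solid arcs, with incidences
    preserved, and the degree of a vertex cannot decrease
    ([degr_embedding]).  Hence [degr p] and [degr q] are both at most the
    degree of the composite ([degr_comp_l], [degr_comp_r]).

    It remains to extend this from cliques to linear combinations.  The
    elements whose composite with a fixed element lies in a given subspace form
    a subspace, since composition is bilinear; so it suffices to check the
    closure conditions on generators, which are a clique of large degree and an
    arbitrary clique. *)

Set Implicit Arguments.
Unset Strict Implicit.
Unset Printing Implicit Defensive.

Import GRing.Theory.
Local Open Scope ring_scope.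

Section Span.
Variables (K : fieldType) (V : lmodType K).
Implicit Types (S T : V -> Prop).

Lemma linear_span_subspace S : subspace (linear_span S).
Proof.
split; first by exists 0%N, (fun=> 0), (fun=> 0); split=> [[]|] //; rewrite big_ord0.
move=> a _ _ [r [c [u [Su ->]]]] [s [d [v [Sv ->]]]].
exists (r + s)%N.
exists (fun i => match split i with inl j => a * c j | inr j => d j end).
exists (fun i => match split i with inl j => u j | inr j => v j end).
split=> [i|]; first by case: (split i).
rewrite big_split_ord scaler_sumr; congr (_ + _); apply: eq_bigr => i _.
  by rewrite -[lshift _ _]/(unsplit (inl i)) unsplitK scalerA.
by rewrite -[rshift _ _]/(unsplit (inr i)) unsplitK.
Qed.

Lemma linear_span_gen S v : S v -> linear_span S v.
Proof.
by move=> Sv; exists 1%N, (fun=> 1), (fun=> v); rewrite big_ord1 scale1r.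
Qed.

Lemma subspace_sum T (I : eqType) (s : seq I) (c : I -> K) (u : I -> V) :
  subspace T -> (forall i, T (u i)) -> T (\sum_(i <- s) c i *: u i).
Proof.
move=> [T0 TD] Tu; elim: s => [|i s IH]; first by rewrite big_nil.
by rewrite big_cons; apply: TD.
Qed.

Lemma linear_span_min S T :
  subspace T -> (forall v, S v -> T v) -> forall v, linear_span S v -> T v.
Proof.
move=> subT ST _ [r [c [u [Su ->]]]].
by apply: subspace_sum => // i; exact: ST.
Qed.

End Span.

Lemma subspace_preim (K : fieldType) (V W : lmodType K) (f : V -> W)
    (T : W -> Prop) :
  linear f -> subspace T -> subspace (fun v => T (f v)).
Proof.
move=> lf [T0 TD]; split=> [|a u v Tu Tv]; last by rewrite lf; exact: TD.
suff -> : f 0 = 0 by [].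
by have := lf (-1) 0 0; rewrite scaler0 addr0 scaleN1r addNr.
Qed.

Lemma subspace_cliques (K : fieldType) (M : umagmaType) n
    (T : cliques_space K M n -> Prop) :
  subspace T -> (forall p, T << p >>) -> forall x, T x.
Proof.
move=> subT Tp x; rewrite (monalgE x).
rewrite (eq_bigr (fun p => x@_p *: (<< p >> : cliques_space K M n))).
  exact: subspace_sum.
by move=> p _; exact: malgU_scale.
Qed.

Section Degree.
Variable M : umagmaType.

(** The inequality holds vertex by vertex: the arcs at [x] embed in the arcs
    at [g x]. *)
Lemma degr_embedding n n' (p : clique M n) (r : clique M n')
    (g : nat -> nat) :
  {homo g : x y / (x < y)%N} ->
  (forall x, (x <= n)%N -> (g x <= n')%N) ->
  (forall x y, (x < y <= n)%N ->
     label p x y != 1%g -> label r (g x) (g y) != 1%g) ->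
  (degr p <= degr r)%N.
Proof.
move=> g_lt g_le g_solid.
have gK (x : 'I_n.+1) : @inord n' (g x) = g x :> nat.
  by rewrite inordK // ltnS g_le // -ltnS.
have inj_g (x y : 'I_n.+1) : @inord n' (g x) = inord (g y) -> x = y.
  move=> /(congr1 val) /=; rewrite !gK => gxy; apply/val_inj => /=.
  by case: (ltngtP x y) => // /g_lt; rewrite gxy ltnn.
have arcP (a : Defs.arc n) :
    (@inord n' (g (arc_src a)) < @inord n' (g (arc_tgt a)))%N.
  by rewrite !gK; apply: g_lt; exact: (valP a).
pose phi (a : Defs.arc n) : Defs.arc n' :=
  exist (fun b : 'I_n'.+1 * 'I_n'.+1 => b.1 < b.2)%N
    (inord (g (arc_src a)), inord (g (arc_tgt a))) (arcP a).
have src_phi a : arc_src (phi a) = inord (g (arc_src a)) by [].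
have tgt_phi a : arc_tgt (phi a) = inord (g (arc_tgt a)) by [].
have inj_phi : injective phi.
  move=> a b eab; apply/val_inj.
  rewrite [val a]surjective_pairing [val b]surjective_pairing.
  by congr pair; apply: inj_g; rewrite -/(arc_src _) -/(arc_tgt _)
    -?src_phi -?tgt_phi eab.
apply/bigmax_leqP => x _.
apply: leq_trans (leq_bigmax (@inord n' (g x))).
rewrite /degree -(card_imset _ inj_phi); apply/subset_leq_card/subsetP => b.
case/imsetP => a; rewrite inE => /andP[solid_a inc_a] ->; rewrite inE.
apply/andP; split; last first.
  by rewrite src_phi tgt_phi; case/orP: inc_a => /eqP ->; rewrite eqxx ?orbT.
rewrite /solid -labelE src_phi tgt_phi !gK; apply: g_solid.
  by rewrite (valP a) -ltnS ltn_ord.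
by rewrite labelE.
Qed.

Lemma mulg_neq1 (a b : M) : no_nontrivial_unit_divisors M ->
  (a != 1%g) || (b != 1%g) -> (a * b)%g != 1%g.
Proof.
move=> nud; apply: contraTneq => /nud[-> ->].
by rewrite eqxx.
Qed.

(** The place in a composite at [i] of the vertex [x] of the outer clique: the
    inserted clique, of arity [m.+1], separates the vertices [i] and [i.+1] by
    [m] new ones. *)
Definition expand (i m x : nat) : nat := if (x <= i)%N then x else (x + m)%N.

Lemma degr_comp_l n m (i : 'I_n.+1) (p : clique M n.+1) (q : clique M m.+1) :
  no_nontrivial_unit_divisors M -> (degr p <= degr (clique_comp i p q))%N.
Proof.
move=> nud; have le_i := ltn_ord i.
apply: (@degr_embedding _ _ _ _ (expand i m)).
- by move=> x y; rewrite /expand; case: (leqP x i); case: (leqP y i); lia.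
- by move=> x; rewrite /expand; case: (leqP x i); lia.
move=> x y xy px; rewrite label_comp ifT; last first.
  by rewrite /expand; case: (leqP x i); case: (leqP y i); lia.
rewrite /comp_label /expand.
have [yi|iy] := leqP y i; first by rewrite yi !ifT //; lia.
rewrite ifF; last by lia.
have [xi|ix] := leqP x i.
  have [/eqP xe|xe] /= := boolP (x == i :> nat).
    have [ye|ye] := eqVneq y i.+1.
      (* The edge [p_i], merged with the base of [q]. *)
      rewrite ifT; last by lia.
      by rewrite mulg_neq1 // -ye -xe px.
    rewrite ifF; last by lia.
    by rewrite ifT ?addnK //; lia.
  by rewrite ifT ?addnK //; lia.
rewrite ifF; last by lia.
rewrite ifF; last by lia.
by rewrite ifT ?addnK //; lia.
Qed.

Lemma degr_comp_r n m (i : 'I_n.+1) (p : clique M n.+1) (q : clique M m.+1) :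
  no_nontrivial_unit_divisors M -> (degr q <= degr (clique_comp i p q))%N.
Proof.
move=> nud; have le_i := ltn_ord i.
apply: (@degr_embedding _ _ _ _ (addn^~ i)).
- by move=> x y /=; lia.
- by move=> x /=; lia.
move=> x y xy qx; rewrite label_comp ifT; last by lia.
rewrite /comp_label ifF; last by lia.
case: ifP => [base|not_base].
  (* [(x, y)] is the base of [q], merged with the edge [p_i]. *)
  have <- : label q x y = label q 0 m.+1 by apply: (f_equal2 (label q)); lia.
  by rewrite mulg_neq1 // qx orbT.
rewrite ifF; last by lia.
rewrite ifF; last by lia.
by rewrite ifT ?addnK //; lia.
Qed.

End Degree.

Theorem proposition3p1p5 (K : fieldType) (charK0 : [pchar K]%R =i pred0)
    (M : umagmaType) (unit_divisorsM : no_nontrivial_unit_divisors M)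
    (k : nat) :
  operad_ideal (clique_operad K M) (large_degree_span K M k).
Proof.
have subI n : subspace (large_degree_span K M k n).
  exact: linear_span_subspace.
split=> // [n m i x y Iy | n m i y x Iy].
- move: y Iy; apply: linear_span_min => [|_ [q kq ->]].
    exact: (subspace_preim (cliques_comp_linear_r i x) (subI _)).
  move: x; apply: subspace_cliques => [|p].
    exact: (subspace_preim (cliques_comp_linear_l i _) (subI _)).
  rewrite /= cliques_compU; apply: linear_span_gen.
  by exists (clique_comp i p q) => //; apply: leq_trans (degr_comp_r _ _ _ _).
- move: y Iy; apply: linear_span_min => [|_ [p kp ->]].
    exact: (subspace_preim (cliques_comp_linear_l i x) (subI _)).
  move: x; apply: subspace_cliques => [|q].
    exact: (subspace_preim (cliques_comp_linear_r i _) (subI _)).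
  rewrite /= cliques_compU; apply: linear_span_gen.
  by exists (clique_comp i p q) => //; apply: leq_trans (degr_comp_l _ _ _ _).
Qed.
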